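(* For every integer $n\ge1$, $spt_{2,3}(3n)\equiv spt(n)\pmod 3$.
   Context: $(a;q)_\infty=\prod_{k\ge0}(1-aq^k)$ and $(a;q)_n=\prod_{k=0}^{n-1}(1-aq^k)$. The function $spt_{2,3}(n)$ is defined by $$\sum_{n\ge1}spt_{2,3}(n)q^n=\sum_{n\ge1}\frac{q^n}{(1-q^n)\,(1-q^n)(1-q^{n+1})\cdots(1-q^{2n-1})\,(q^{3n};q^3)_{\infty}};$$ combinatorially, it is the total number of appearances of the smallest part $s$, summed over all partitions of $n$ in which every part other than $s$ is either strictly between $s$ and $2s$ or a multiple of $3$ that is at least $3s$. $spt(n)$ is the total number of appearances of the smallest part summed over all partitions of $n$, i.e. $\sum_{n\ge1}spt(n)q^n=\sum_{n\ge1}\frac{q^n}{(1-q^n)^2(q^{n+1};q)_\infty}$. *)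

(* Defs.v *)
From HB Require Import structures.
From mathcomp Require Import all_boot all_order all_algebra.
From mathcomp Require Import boolp.

Set Implicit Arguments.
Unset Strict Implicit.
Unset Printing Implicit Defensive.

Import GRing.Theory.

Local Open Scope ring_scope.

(* Formal power series in one variable over R; f i is the coefficient of q^i. *)
Record fps (R : Type) := Fps { fps_coef : nat -> R }.

Coercion fps_coef : fps >-> Funclass.

Lemma fpsP (R : Type) (f g : fps R) : (forall i, f i = g i) <-> f = g.
Proof.
split=> [|-> //]; case: f g => [f] [g] /= fg.
by congr Fps; apply/funext.
Qed.

HB.instance Definition _ (R : Type) := gen_eqMixin (fps R).
HB.instance Definition _ (R : Type) := gen_choiceMixin (fps R).

Section FpsZmodule.
Variable R : zmodType.
Implicit Types f g h : fps R.

Definition fps_zero : fps R := Fps (fun=> 0).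
Definition fps_opp f : fps R := Fps (fun i => - f i).
Definition fps_add f g : fps R := Fps (fun i => f i + g i).

Fact fps_addA : associative fps_add.
Proof. by move=> f g h; apply/fpsP => i /=; rewrite addrA. Qed.

Fact fps_addC : commutative fps_add.
Proof. by move=> f g; apply/fpsP => i /=; rewrite addrC. Qed.

Fact fps_add0 : left_id fps_zero fps_add.
Proof. by move=> f; apply/fpsP => i /=; rewrite add0r. Qed.

Fact fps_addN : left_inverse fps_zero fps_opp fps_add.
Proof. by move=> f; apply/fpsP => i /=; rewrite addNr. Qed.

HB.instance Definition _ :=
  GRing.isZmodule.Build (fps R) fps_addA fps_addC fps_add0 fps_addN.

Lemma fps_coef0 i : (0 : fps R) i = 0. Proof. by []. Qed.
Lemma fps_coefN f i : (- f) i = - f i. Proof. by []. Qed.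
Lemma fps_coefD f g i : (f + g) i = f i + g i. Proof. by []. Qed.
Lemma fps_coefB f g i : (f - g) i = f i - g i. Proof. by []. Qed.

Lemma fps_coef_sum (I : Type) (r : seq I) (P : pred I) (F : I -> fps R) i :
  (\sum_(x <- r | P x) F x) i = \sum_(x <- r | P x) F x i.
Proof. by apply: (big_morph (fun f : fps R => f i)). Qed.

End FpsZmodule.

Section FpsRing.
Variable R : comUnitRingType.
Implicit Types f g h : fps R.

Definition fps_one : fps R := Fps (fun i => (i == 0)%:R).
Definition fps_mul f g : fps R :=
  Fps (fun n => \sum_(i < n.+1) f i * g (n - i)%N).

Definition fps_trunc n f : {poly R} := \poly_(i < n.+1) f i.

Lemma coef_fps_mul n f g i : (i <= n)%N ->
  fps_mul f g i = (fps_trunc n f * fps_trunc n g)`_i.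
Proof.
move=> le_in; rewrite coefM; apply: eq_bigr => -[j /=]; rewrite ltnS => le_ji _.
by rewrite !coef_poly !ltnS (leq_trans le_ji) // (leq_trans (leq_subr _ _)).
Qed.

Lemma coef_fps_trunc n f i : (i <= n)%N -> (fps_trunc n f)`_i = f i.
Proof. by move=> le_in; rewrite coef_poly ltnS le_in. Qed.

Fact fps_mulC : commutative fps_mul.
Proof. by move=> f g; apply/fpsP => n; rewrite !(coef_fps_mul _ _ (leqnn n)) mulrC. Qed.

Fact fps_mulA : associative fps_mul.
Proof.
move=> f g h; apply/fpsP => n; rewrite !(coef_fps_mul _ _ (leqnn n)).
transitivity ((fps_trunc n f * (fps_trunc n g * fps_trunc n h))`_n).
  rewrite !coefM; apply: eq_bigr => i _; congr (_ * _).
  by rewrite coef_fps_trunc ?leq_subr // (coef_fps_mul _ _ (leq_subr i n)).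
rewrite mulrA !coefM; apply: eq_bigr => -[i /=]; rewrite ltnS => le_in _.
by congr (_ * _); rewrite coef_fps_trunc // (coef_fps_mul _ _ le_in).
Qed.

Fact fps_mul1 : left_id fps_one fps_mul.
Proof.
move=> f; apply/fpsP => n; rewrite /fps_mul /= big_ord_recl /= subn0 mul1r.
by rewrite big1 ?addr0 // => i _; rewrite mul0r.
Qed.

Fact fps_mulDl : left_distributive fps_mul +%R.
Proof.
move=> f g h; apply/fpsP => n; rewrite /fps_mul /= -big_split /=.
by apply: eq_bigr => i _; rewrite mulrDl.
Qed.

Fact fps_one_neq0 : fps_one != 0.
Proof. by apply/eqP => /fpsP /(_ 0%N) /= /eqP; rewrite oner_eq0. Qed.

HB.instance Definition _ :=
  GRing.Zmodule_isComNzRing.Build (fps R)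
    fps_mulA fps_mulC fps_mul1 fps_mulDl fps_one_neq0.

Lemma fps_coef1 i : (1 : fps R) i = (i == 0)%:R. Proof. by []. Qed.

Lemma fps_coefM f g n : (f * g) n = \sum_(i < n.+1) f i * g (n - i)%N.
Proof. by []. Qed.

(* The coefficients of f^-1 up to degree n, computed from the recurrence       *)
(* f 0 * f^-1 n = - \sum_(1 <= i <= n) f i * f^-1 (n - i).                     *)
Fixpoint fps_inv_seq f n : seq R :=
  if n is m.+1 then
    let s := fps_inv_seq f m in
    rcons s (- (f 0%N)^-1 * \sum_(i < m.+1) f i.+1 * s`_(m - i))
  else [:: (f 0%N)^-1].

Definition fps_unit : {pred fps R} := [pred f : fps R | f 0%N \is a GRing.unit].

Definition fps_inv f : fps R :=
  if f \in fps_unit then Fps (fun n => (fps_inv_seq f n)`_n) else f.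

Lemma size_fps_inv_seq f n : size (fps_inv_seq f n) = n.+1.
Proof. by elim: n => //= n IHn; rewrite size_rcons IHn. Qed.

Lemma nth_fps_inv_seq f n i : (i <= n)%N ->
  (fps_inv_seq f n)`_i = (fps_inv_seq f i)`_i.
Proof.
elim: n => [|n IHn]; first by rewrite leqn0 => /eqP ->.
rewrite leq_eqVlt => /predU1P[-> //|le_in].
by rewrite [in LHS]/= nth_rcons size_fps_inv_seq le_in IHn.
Qed.

Fact fps_mulV : {in fps_unit, left_inverse 1 fps_inv *%R}.
Proof.
move=> f Uf; rewrite mulrC /fps_inv Uf; rewrite inE in Uf.
apply/fpsP => -[|n]; rewrite fps_coefM big_ord_recl /= ?big_ord0 ?addr0.
  by rewrite divrr.
rewrite nth_rcons size_fps_inv_seq ltnn eqxx mulrA mulrN divrr // mulN1r addrC.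
apply/eqP; rewrite subr_eq0; apply/eqP; apply: eq_bigr => i _.
by rewrite /bump /= add1n subSS (nth_fps_inv_seq _ (leq_subr i n)).
Qed.

Fact fps_unitP f g : g * f = 1 -> fps_unit f.
Proof.
move=> /fpsP /(_ 0%N); rewrite fps_coefM big_ord1 /= => gf1.
by apply/unitrP; exists (g 0%N); rewrite gf1 mulrC gf1.
Qed.

Fact fps_inv_out : {in [predC fps_unit], fps_inv =1 id}.
Proof. by move=> f; rewrite inE /= /fps_inv => /negPf ->. Qed.

HB.instance Definition _ :=
  GRing.ComNzRing_hasMulInverse.Build (fps R) fps_mulV fps_unitP fps_inv_out.

Lemma fps_unitE f : (f \is a GRing.unit) = (f 0%N \is a GRing.unit).
Proof. by []. Qed.

Definition fps_q : fps R := Fps (fun i => (i == 1)%:R).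

Lemma fps_coefqn n i : (fps_q ^+ n) i = (i == n)%:R.
Proof.
elim: n i => [//|n IHn] [|i]; rewrite exprS fps_coefM big_ord_recl mul0r add0r.
  by rewrite big_ord0.
rewrite big_ord_recl /= mul1r subSS subn0 IHn eqSS big1 ?addr0 // => j _.
by rewrite mul0r.
Qed.

(* The limit of a sequence of power series, meaningful when u k and u k.+1     *)
(* agree below degree k for all k; then, by fps_limE, the coefficient of q^i   *)
(* in u k is that of the limit as soon as k > i.                               *)
Definition fps_lim (u : nat -> fps R) : fps R := Fps (fun i => u i.+1 i).

Lemma fps_limE (u : nat -> fps R) :
  (forall k i, (i < k)%N -> u k.+1 i = u k i) ->
  forall k i, (i < k)%N -> u k i = fps_lim u i.
Proof.
move=> uP; elim=> [//|k IHk] i; rewrite ltnS leq_eqVlt => /predU1P[-> //|lt_ik].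
by rewrite uP // IHk.
Qed.

(* \sum_(n >= 1) F n, for F n of order at least n *)
Definition fps_sum1 (F : nat -> fps R) : fps R :=
  fps_lim (fun K => \sum_(1 <= n < K) F n).

Lemma fps_sum1E (F : nat -> fps R) :
  (forall n i, (i < n)%N -> F n i = 0) ->
  forall k i, (i < k)%N -> (\sum_(1 <= n < k) F n) i = fps_sum1 F i.
Proof.
move=> FP; apply: fps_limE => -[//|k] i lt_ik.
by rewrite big_nat_recr //= FP // addr0.
Qed.

(* \prod_(n >= 0) F n, for F n - 1 of order at least n *)
Definition fps_prod0 (F : nat -> fps R) : fps R :=
  fps_lim (fun K => \prod_(n < K) F n).

Lemma fps_prod0E (F : nat -> fps R) :
  (forall n i, (i < n)%N -> (F n - 1) i = 0) ->
  forall k i, (i < k)%N -> (\prod_(n < k) F n) i = fps_prod0 F i.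
Proof.
move=> FP; apply: fps_limE => k i lt_ik; suff E P : (P * F k) i = P i by rewrite big_ord_recr E.
rewrite -[F k](subrK 1) mulrDr mulr1 fps_coefD fps_coefM big1 ?add0r // => j _.
by rewrite FP ?mulr0 // (leq_ltn_trans (leq_subr _ _)).
Qed.

(* (a; x)_n *)
Definition qpoch (a x : fps R) (n : nat) : fps R :=
  \prod_(k < n) (1 - a * x ^+ k).

(* (a; x)_oo, for x without constant term *)
Definition qpoch_inf (a x : fps R) : fps R :=
  fps_prod0 (fun k => 1 - a * x ^+ k).

Lemma qpoch_infE (a x : fps R) : x 0%N = 0 ->
  forall k i, (i < k)%N -> qpoch a x k i = qpoch_inf a x i.
Proof.
move=> x0; apply: fps_prod0E => n i lt_in.
rewrite addrAC subrr add0r fps_coefN.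
suff H m : forall j, (j < m)%N -> (x ^+ m) j = 0.
  rewrite fps_coefM big1 ?oppr0 // => j _.
  by rewrite H ?mulr0 // (leq_ltn_trans (leq_subr _ _)).
elim: m => [//|m IHm] j lt_jm; rewrite exprS fps_coefM big_ord_recl x0 mul0r add0r.
rewrite big1 // => -[l /= lt_lj] _.
rewrite /bump add1n IHm ?mulr0 //.
by rewrite -ltnS (leq_trans _ lt_jm) // ltnS ltn_subrL (leq_ltn_trans _ lt_lj).
Qed.

End FpsRing.

Arguments fps_q {R}.

Definition spt23_term (n : nat) : fps int :=
  fps_q ^+ n /
  ((1 - fps_q ^+ n) * qpoch (fps_q ^+ n) fps_q n
   * qpoch_inf (fps_q ^+ (3 * n)) (fps_q ^+ 3)).

(* (q^n; q)_n = (1 - q^n)(1 - q^(n+1)) ... (1 - q^(2n-1)) *)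
Definition spt23 : nat -> int := fps_sum1 spt23_term.

(* The infinite sum defining spt23 converges. *)
Lemma spt23_term_order n i : (i < n)%N -> spt23_term n i = 0.
Proof.
move=> lt_in; rewrite /spt23_term fps_coefM big1 // => -[j /= lt_ji] _.
by rewrite fps_coefqn ltn_eqF ?mul0r // (leq_ltn_trans _ lt_in) // -ltnS.
Qed.

(* All the divisions in the series defining spt23 are by invertible series. *)
Lemma spt23_denom_unit n : (0 < n)%N ->
  (1 - fps_q ^+ n) * qpoch (fps_q ^+ n) fps_q n
  * qpoch_inf (fps_q ^+ (3 * n)) (fps_q ^+ 3) \is a @GRing.unit (fps int).
Proof.
move=> n_gt0.
have U m : (0 < m)%N -> 1 - fps_q ^+ m \is a @GRing.unit (fps int).
  by move=> m_gt0; rewrite fps_unitE fps_coefB fps_coefqn ltn_eqF ?subr0.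
rewrite !unitrM U //=; apply/andP; split.
  by rewrite /qpoch; apply: rpred_prod => k _; rewrite -exprD U ?ltn_addr.
rewrite fps_unitE -(@qpoch_infE _ _ _ _ 1) ?fps_coefqn // -fps_unitE.
by rewrite /qpoch big_ord1 mulr1 U ?muln_gt0.
Qed.

(* Partitions of n, by multiplicities: l i is the number of parts equal to     *)
(* i + 1. All parts and multiplicities are at most n.                          *)
Definition is_partition (n : nat) (l : {ffun 'I_n -> 'I_n.+1}) : bool :=
  (\sum_(i < n) i.+1 * l i == n)%N.

Definition is_smallest_part (n : nat) (l : {ffun 'I_n -> 'I_n.+1}) (s : 'I_n) : bool :=
  (0 < l s)%N && [forall i : 'I_n, (i < s)%N ==> (l i == 0 :> nat)].

Definition spt (n : nat) : nat :=
  (\sum_(l : {ffun 'I_n -> 'I_n.+1} | is_partition l)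
     \sum_(s < n | is_smallest_part l s) l s)%N.

(* Main.v *)
(* Write L t = q^t / (1 - q^t)^2. If (a, b) is a Bailey pair relative to 1 with
   a_0 = 1, then
     \sum_(n >= 1) (q)_(n-1)^2 q^n b_n
       = \sum_(n >= 1) L n + \sum_(r >= 1) a_r L r.
   For b_n = 1 / (q)_n, whose a_r = (-1)^r q^(r(3r-1)/2) (1 + q^r) are the
   pentagonal coefficients, the left-hand side is (q)_oo times the generating
   function of spt. For b_n = (q^3; q^3)_(n-1) / ((q)_(2n-1) (q)_n), it is
   (q^3; q^3)_oo times the generating function of spt23, and a_r is supported on
   the multiples of 3, with a_(3r) obtained from the pentagonal a_r by q |-> q^3.
   Hence extracting the exponents divisible by 3 in the second identity gives the
   first one, except that sigma(n), the coefficient of q^n in \sum L n, becomes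
   sigma(3n), which is congruent to sigma(n) modulo 3. *)
From HB Require Import structures.
Require Import Defs.
From mathcomp Require Import all_boot all_order all_algebra.
From mathcomp Require Import ring zify.

Set Implicit Arguments.
Unset Strict Implicit.
Unset Printing Implicit Defensive.

Import GRing.Theory.

Local Open Scope ring_scope.

(** * Sums over multiples, q-factorials and pentagonal coefficients *)

Lemma sum_dvd_ord (V : nmodType) (F : nat -> V) d K : (0 < d)%N ->
  \sum_(m < d * K | (d %| m)%N) F m = \sum_(j < K) F (d * j)%N.
Proof.
case: d => // d _; elim: K => [|K IHK]; first by rewrite muln0 !big_ord0.
rewrite big_ord_recr /= -IHK mulnSr big_split_ord /=; congr (_ + _).
rewrite big_mkcond big_ord_recl /= addn0 dvdn_mulr // big1 ?addr0 // => i _.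
by rewrite dvdn_addr ?dvdn_mulr // gtnNdvd // /bump add1n ltnS.
Qed.

Lemma sum_dvd_ordS (V : nmodType) (F : nat -> V) d K : (0 < d)%N ->
  \sum_(m < (d * K).+1 | (d %| m)%N) F m = \sum_(j < K.+1) F (d * j)%N.
Proof.
move=> d_gt0; rewrite big_mkcond big_ord_recr /= dvdn_mulr // -big_mkcond.
by rewrite sum_dvd_ord // big_ord_recr.
Qed.

Definition qfact (R : pzRingType) (q : R) n : R := \prod_(k < n) (1 - q ^+ k.+1).

Lemma qfactS (R : pzRingType) (q : R) n :
  qfact q n.+1 = qfact q n * (1 - q ^+ n.+1).
Proof. by rewrite /qfact big_ord_recr. Qed.

(* 3 C(r, 2) + r is the pentagonal number r(3r - 1)/2. *)
Definition pent_alpha (R : pzRingType) (q : R) (r : nat) : R :=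
  if r == 0%N then 1
  else (-1) ^+ r * q ^+ (3 * 'C(r, 2) + r) * (1 + q ^+ r).

Lemma pent_alphaS (R : pzRingType) (q : R) r :
  pent_alpha q r.+1 = (-1) ^+ r.+1 * q ^+ (3 * 'C(r.+1, 2) + r.+1) * (1 + q ^+ r.+1).
Proof. by []. Qed.

(** * Bailey pairs relative to 1, over any ring where the 1 - q^k are invertible *)

Section BaileyPairs.

Variables (R : comUnitRingType) (q : R).
Hypothesis one_sub_qU : forall k, (0 < k)%N -> 1 - q ^+ k \is a GRing.unit.

Local Notation P := (qfact q).
Local Notation V n := (P n)^-1.
Local Notation L t := (q ^+ t / (1 - q ^+ t) ^+ 2).

Lemma qfact_unit n : P n \is a GRing.unit.
Proof. by apply: rpred_prod => k _; apply: one_sub_qU. Qed.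

Lemma qfactV n : V n = (1 - q ^+ n.+1) * V n.+1.
Proof.
by rewrite qfactS invrM ?qfact_unit ?one_sub_qU // mulrA divrr ?mul1r ?one_sub_qU.
Qed.

(* 1 / (q; q)_(n - r), with the convention that it vanishes for r > n *)
Definition inv_qfact_sub n r : R := if (r <= n)%N then V (n - r) else 0.

(** No bound on r is needed: at r = n + 1 the factor 1 - q^0 vanishes, and beyond that both sides
    are 0 by convention. *)
Lemma inv_qfact_subS n r :
  inv_qfact_sub n r = (1 - q ^+ (n.+1 - r)) * inv_qfact_sub n.+1 r.
Proof.
rewrite /inv_qfact_sub; case: leqP => [le_rn|]; last first.
  rewrite leq_eqVlt => /predU1P[<-|lt_nr]; first by rewrite leqnn subnn subrr mul0r.
  by rewrite leqNgt lt_nr mulr0.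
by rewrite (leq_trans le_rn) // subSn // -qfactV.
Qed.

(* 1 / ((q; q)_(n - r) (q; q)_(n + r)) *)
Definition bailey_term n r : R := inv_qfact_sub n r * V (n + r).

Lemma bailey_term_gt n r : (n < r)%N -> bailey_term n r = 0.
Proof. by move=> lt_nr; rewrite /bailey_term /inv_qfact_sub leqNgt lt_nr mul0r. Qed.

Lemma lambertE t : (0 < t)%N -> q ^+ t = L t * (1 - q ^+ t) ^+ 2.
Proof. by move=> t_gt0; rewrite divrK // unitrX // one_sub_qU. Qed.

(** With x = q^(N+1), (1 - x)^2 - (1 - x q^(-r)) (1 - x q^r) = x q^(-r) (1 - q^r)^2, and multiplying
    by L r leaves exactly x. *)
Lemma bailey_weightS N r : (0 < r)%N -> (r <= N.+1)%N ->
  L r * P N.+1 ^+ 2 * bailey_term N.+1 r =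
  L r * P N ^+ 2 * bailey_term N r + P N ^+ 2 * q ^+ N.+1 * bailey_term N.+1 r.
Proof.
move=> r_gt0 le_rN; rewrite {2}/bailey_term inv_qfact_subS qfactV -addSn qfactS.
rewrite /bailey_term addSn.
have -> : q ^+ (N + r).+1 = q ^+ N.+1 * q ^+ r by rewrite -exprD addSn.
have EN : q ^+ N.+1 = q ^+ (N.+1 - r) * q ^+ r by rewrite -exprD subnK.
rewrite EN; move: (q ^+ (N.+1 - r)) => u.
rewrite [X in _ + P N ^+ 2 * (u * X) * _](lambertE r_gt0).
move: (L r) (q ^+ r) (P N) (inv_qfact_sub _ _) (P _)^-1 => *; ring.
Qed.

(* The partial sums of the conjugate Bailey pair
   \sum_n (q)_(n-1)^2 q^n / ((q)_(n-r) (q)_(n+r)) are in closed form, which is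
   why no limit (and no q-Gauss sum) is needed here. *)
Lemma bailey_sum (a b : nat -> R) N :
    (forall n, (0 < n)%N -> b n = \sum_(r < n.+1) a r * bailey_term n r) ->
  \sum_(1 <= n < N.+1) P n.-1 ^+ 2 * q ^+ n * b n =
  a 0%N * (\sum_(1 <= n < N.+1) L n) +
  \sum_(1 <= r < N.+1) a r * (L r * P N ^+ 2 * bailey_term N r).
Proof.
move=> bE; elim: N => [|N IHN]; first by rewrite !big_geq // mulr0 addr0.
rewrite big_nat_recr //= IHN [in RHS]big_nat_recr //= mulrDr -!addrA; congr (_ + _).
have -> : \sum_(1 <= r < N.+2) a r * (L r * P N.+1 ^+ 2 * bailey_term N.+1 r) =
    \sum_(1 <= r < N.+2) a r * (L r * P N ^+ 2 * bailey_term N r) +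
    P N ^+ 2 * q ^+ N.+1 * \sum_(1 <= r < N.+2) a r * bailey_term N.+1 r.
  rewrite big_distrr -big_split /=; apply: eq_big_nat => r /andP[r_gt0 le_rN].
  by rewrite bailey_weightS //; ring.
rewrite [in RHS]big_nat_recr //= (bailey_term_gt (ltnSn N)) !mulr0 addr0 addrCA.
congr (_ + _); rewrite bE // -(big_mkord xpredT (fun r => a r * bailey_term N.+1 r)).
(* The term r = 0 of [b N.+1] carries the weight (q)_N^2 q^(N+1) / (q)_(N+1)^2 = L (N+1), which
   extends the Lambert sum. *)
rewrite big_nat_recl // big_add1 /= mulrDr; congr (_ + _).
rewrite /bailey_term /inv_qfact_sub /= subn0 addn0 qfactS.
have U := qfact_unit N; have U1 := one_sub_qU (ltn0Sn N).
have E : P N * (P N)^-1 = 1 by rewrite divrr.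
rewrite invrM // -exprVn; move: (_ ^-1) ((P N)^-1) E => u v E.
(* [ring] treats the inverse v of P N as an independent variable, so the cancellation is supplied as
   (P N * v)^2 = 1. *)
rewrite -[RHS]mulr1; have -> : 1 = (P N * v) ^+ 2 :> R by rewrite E expr1n.
ring.
Qed.

(* The closed forms of the partial sums here and in cubic_bailey_partial are
   q-Zeilberger certificates for the first-order recurrences in n satisfied by
   the sums of pent_bailey and cubic_bailey. *)
Lemma pent_bailey_partial n k : (k <= n)%N ->
  \sum_(r < k.+1) pent_alpha q r *
    ((1 - q ^+ n.+1) * bailey_term n.+1 r - bailey_term n r) =
  (-1) ^+ k * q ^+ (n.+1 + 3 * 'C(k.+1, 2)) * (V (n - k) * V (n.+1 + k)).
Proof.
elim: k => [_|k IHk lt_kn].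
  rewrite big_ord1 /pent_alpha /bailey_term /inv_qfact_sub /= !subn0 !addn0 (qfactV n).
  by move: (q ^+ n.+1) (V n.+1) => *; ring.
rewrite big_ord_recr IHk ?(ltnW lt_kn) //= pent_alphaS.
rewrite /bailey_term (inv_qfact_subS n) /inv_qfact_sub (leqW lt_kn).
(* Naming the difference m removes truncated subtractions, leaving a polynomial identity in q^m, q^k
   and q^e. *)
have [m Em] : exists m, n = (m + k.+1)%N by exists (n - k.+1)%N; rewrite subnK.
subst n.
have -> : (m + k.+1 - k = m.+1)%N by lia.
rewrite -addSn !addnK [V m]qfactV.
have -> : (m.+1 + k.+1 + k = m + k.+1 + k.+1)%N by lia.
rewrite [V (m + k.+1 + k.+1)]qfactV -!addSn.
have -> : (3 * 'C(k.+2, 2) = 3 * 'C(k.+1, 2) + k + k + k + 3)%N by rewrite binS bin1; lia.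
move: (3 * 'C(k.+1, 2))%N => e; rewrite !exprD !exprS !expr0.
by move: (V _) (V _) (q ^+ m) (q ^+ k) (q ^+ e) ((-1) ^+ k) => *; ring.
Qed.

(** Both sides satisfy (1 - q^(n+1)) S_(n+1) = S_n: the certificate at k = n cancels the remaining
    term r = n + 1 of S_(n+1). *)
Lemma pent_bailey n : V n = \sum_(r < n.+1) pent_alpha q r * bailey_term n r.
Proof.
elim: n => [|n IHn].
  rewrite big_ord1 /pent_alpha /bailey_term /inv_qfact_sub /= /qfact big_ord0.
  by rewrite invr1 !mul1r.
apply: (mulrI (one_sub_qU (ltn0Sn n))); rewrite -qfactV IHn.
apply/esym/eqP; rewrite -subr_eq0 big_distrr big_ord_recr /= addrAC -sumrB.
under eq_bigr => r _ do rewrite mulrCA -mulrBr.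
rewrite pent_bailey_partial // subnn pent_alphaS /bailey_term /inv_qfact_sub leqnn subnn.
rewrite [V (n.+1 + n)]qfactV; move: (3 * 'C(n.+1, 2))%N => e.
rewrite !addnS !addSn !exprS !exprD.
apply/eqP; move: (V _) (V _) ((-1) ^+ n) (q ^+ n) (q ^+ e) => *; ring.
Qed.

Lemma cubic_bailey_partial n k : (0 < n)%N ->
  \sum_(j < k.+1) pent_alpha (q ^+ 3) j *
    ((1 - q ^+ n ^+ 2) * (1 - q ^+ n.*2.+1) * (1 - q ^+ n.+1) * bailey_term n.+1 (3 * j)
     - (1 - q ^+ n ^+ 3) * bailey_term n (3 * j)) =
  (-1) ^+ k * q ^+ (n.+1 + 9 * 'C(k.+1, 2)) *
    (inv_qfact_sub n (3 * k + 2) * V (n.+1 + 3 * k)).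
Proof.
case: n => // n _; elim: k => [|k IHk].
  rewrite big_ord1 /pent_alpha /bailey_term /inv_qfact_sub /= muln0 add0n !subn0 !addn0.
  (* When the original n is 1, the right-hand side vanishes because [inv_qfact_sub 1 2] is 0. *)
  rewrite -addnn (qfactV n.+1); case: n => [|n] /=.
    by move: (V _) => *; rewrite !expr1; ring.
  rewrite subSS subSS subn0 (qfactV n) (qfactV n.+1) (qfactV n.+2).
  move: (V _) => *; rewrite !addnS !addSn !exprS exprD; move: (q ^+ n) => *; ring.
rewrite big_ord_recr IHk /=.
have -> : (3 * k + 2 = (3 * k.+1).-1)%N by lia.
rewrite pent_alphaS /bailey_term.
(* If 3(k+1) exceeds the larger Bailey index [n.+2], the old closed form, the new term and the new
   closed form all vanish. *)
have [lt_nk|le_kn] := ltnP n.+2 (3 * k.+1)%N.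
  rewrite /inv_qfact_sub.
  do ![rewrite ifN; last by lia].
  by rewrite !(mul0r, mulr0, addr0, subr0).
have [m Em] : exists m, n.+2 = (m + 3 * k.+1)%N by exists (n.+2 - 3 * k.+1)%N; rewrite subnK.
have En : n = (m + 3 * k + 1)%N by lia.
subst n.
have sub0 : inv_qfact_sub (m + 3 * k + 1).+1 (3 * k.+1).-1 = V m.
  rewrite /inv_qfact_sub ifT; last by lia.
  by congr (V _); lia.
have sub1 : inv_qfact_sub (m + 3 * k + 1).+2 (3 * k.+1) = V m.
  rewrite /inv_qfact_sub ifT; last by lia.
  by congr (V _); lia.
rewrite (inv_qfact_subS (m + 3 * k + 1).+1 (3 * k.+1)) sub0 sub1.
have -> : ((m + 3 * k + 1).+2 - 3 * k.+1 = m)%N by lia.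
have -> : ((m + 3 * k + 1).+2 + 3 * k = m + 6 * k + 3)%N by lia.
have -> : ((m + 3 * k + 1).+2 + 3 * k.+1 = (m + 6 * k + 3).+3)%N by lia.
have -> : ((m + 3 * k + 1).+1 + 3 * k.+1 = (m + 6 * k + 3).+2)%N by lia.
rewrite [V (m + 6 * k + 3)]qfactV [V (m + 6 * k + 3).+1]qfactV [V (m + 6 * k + 3).+2]qfactV.
have -> : (9 * 'C(k.+2, 2) = 9 * 'C(k.+1, 2) + (3 * k + 3 * k + 3 * k) + 9)%N.
  by rewrite binS bin1; lia.
rewrite -!(exprM q 3).
have -> : (3 * (3 * 'C(k.+1, 2) + k.+1) = 9 * 'C(k.+1, 2) + 3 * k + 3)%N by lia.
have -> : (3 * k.+1 = 3 * k + 3)%N by lia.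
have -> : ((m + 3 * k + 1).+1.*2.+1 = m + m + (3 * k + 3 * k) + 5)%N by lia.
have -> : (m + 6 * k = m + 3 * k + 3 * k)%N by lia.
move: (V (m + 3 * k + 3 * k + 3).+3) sub0 sub1 => W _ _; move: (9 * _)%N (3 * k)%N => e x.
rewrite !addnS !addSn !addn0 !exprS !exprD.
move: (q ^+ x) (q ^+ e) ((-1) ^+ k) => X E s.
(* The new closed form involves 1 / (q)_(m-3), which is 0 by convention for m < 3; these three
   values are checked one by one. *)
have [m_lt3|m_ge3] := ltnP m 3.
  rewrite [inv_qfact_sub _ _ in RHS]/inv_qfact_sub ifN; last by lia.
  by case: m m_lt3 {Em le_kn IHk} => [|[|[|//]]] _; ring.
rewrite /inv_qfact_sub ifT; last by lia.
have [p Ep] : exists p, m = p.+3 by exists (m - 3)%N; lia.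
subst m; have -> : ((p.+3 + x).+2 - x.+1.+4 = p)%N by lia.
rewrite (qfactV p) (qfactV p.+1) (qfactV p.+2).
by rewrite !exprS; move: (V p.+3) => Y; ring.
Qed.

Definition cubic_alpha m : R :=
  if (3 %| m)%N then pent_alpha (q ^+ 3) (m %/ 3) else 0.

Lemma cubic_alphaM j : cubic_alpha (3 * j) = pent_alpha (q ^+ 3) j.
Proof. by rewrite /cubic_alpha dvdn_mulr // mulKn. Qed.

(** The bound K is left free so that the sums for n and n + 1 can be written over one common
    range. *)
Lemma cubic_sumE n K : (n <= 3 * K)%N ->
  \sum_(m < n.+1) cubic_alpha m * bailey_term n m =
  \sum_(j < K.+1) pent_alpha (q ^+ 3) j * bailey_term n (3 * j).
Proof.
move=> le_nK; under [RHS]eq_bigr => j _ do rewrite -cubic_alphaM.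
rewrite -(@sum_dvd_ordS _ (fun m => cubic_alpha m * bailey_term n m)) //.
rewrite (big_ord_widen (3 * K).+1 (fun m => cubic_alpha m * bailey_term n m)) ?ltnS //.
rewrite big_mkcond [RHS]big_mkcond; apply: eq_bigr => m _ /=.
rewrite /cubic_alpha; case: (3 %| m)%N; case: (ltnP m n.+1) => // lt_nm; rewrite ?mul0r //.
by rewrite bailey_term_gt // mulr0.
Qed.

(** Both sides satisfy (1 - q^(2n)) (1 - q^(2n+1)) (1 - q^(n+1)) b_(n+1) = (1 - q^(3n)) b_n and
    agree at n = 1. *)
Lemma cubic_bailey n : (0 < n)%N ->
  qfact (q ^+ 3) n.-1 * V (n.*2.-1) * V n =
  \sum_(m < n.+1) cubic_alpha m * bailey_term n m.
Proof.
case: n => // n _; elim: n => [|n IHn].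
  rewrite (@cubic_sumE _ 1) // !big_ord_recr big_ord0 /= (@bailey_term_gt _ (3 * 1)) //.
  rewrite mulr0 add0r addr0 /bailey_term /inv_qfact_sub /= subn0 addn0.
  by rewrite [qfact (q ^+ 3) 0]big_ord0 !mul1r.
have U2 : 1 - q ^+ n.+1 ^+ 2 \is a GRing.unit by rewrite -exprM one_sub_qU.
have := cubic_bailey_partial n.+1 (ltn0Sn n).
(* The summation range contains the whole support, so the certificate is 0 and the recurrence is
   homogeneous. *)
rewrite [inv_qfact_sub _ _]ifN; last by lia.
rewrite mul0r mulr0.
under eq_bigr => j _ do
  rewrite mulrBr (mulrCA _ (_ * _ * _) (bailey_term _ _)) (mulrCA _ (1 - _) (bailey_term _ _)).
rewrite sumrB -!big_distrr /= -!cubic_sumE; [|by lia..].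
rewrite -IHn => /eqP; rewrite subr_eq0 => /eqP E.
have U : (1 - q ^+ n.+1 ^+ 2) * (1 - q ^+ n.+1.*2.+1) * (1 - q ^+ n.+2) \is a GRing.unit.
  by rewrite !unitrM U2 !one_sub_qU.
apply: (mulrI U); rewrite E /= [qfact (q ^+ 3) n.+1]qfactS !doubleS (exprAC q 3).
rewrite [V n.*2.+1]qfactV [V n.*2.+2]qfactV [V n.+1]qfactV.
have -> : q ^+ n.*2.+2 = q ^+ n.+1 ^+ 2 by rewrite -exprM; congr (_ ^+ _); lia.
move: (V n.*2.+3) (V n.+2) => x y; ring.
Qed.

End BaileyPairs.

(** * Power series modulo q^K, dilation q |-> q^(d+1), and Lambert series *)

Section FpsCongruence.

Variable R : comUnitRingType.
Implicit Types f g h : fps R.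

Definition fps_eqmod K f g := forall i, (i < K)%N -> f i = g i.

Lemma fps_eqmod_trans K f g h : fps_eqmod K f g -> fps_eqmod K g h -> fps_eqmod K f h.
Proof. by move=> fg gh i lt_iK; rewrite fg ?gh. Qed.

Lemma fps_eqmodW K K' f g : (K' <= K)%N -> fps_eqmod K f g -> fps_eqmod K' f g.
Proof. by move=> le_K fg i lt_i; rewrite fg // (leq_trans lt_i). Qed.

Lemma fps_eqmodD K f f' g g' :
  fps_eqmod K f f' -> fps_eqmod K g g' -> fps_eqmod K (f + g) (f' + g').
Proof. by move=> ff gg i lt_iK; rewrite !fps_coefD ff ?gg. Qed.

Lemma fps_eqmodM K f f' g g' :
  fps_eqmod K f f' -> fps_eqmod K g g' -> fps_eqmod K (f * g) (f' * g').
Proof.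
move=> ff gg i lt_iK; rewrite !fps_coefM; apply: eq_bigr => -[j /= lt_ji] _.
by rewrite ff ?gg // (leq_ltn_trans _ lt_iK) ?leq_subr // -ltnS.
Qed.

Lemma fps_eqmod_sum (I : eqType) (r : seq I) (F G : I -> fps R) K :
    (forall i, i \in r -> fps_eqmod K (F i) (G i)) ->
  fps_eqmod K (\sum_(i <- r) F i) (\sum_(i <- r) G i).
Proof.
move=> FG j lt_jK; rewrite !fps_coef_sum; apply: eq_big_seq => i r_i.
exact: FG.
Qed.

Lemma fps_eqmod_prod (I : Type) (r : seq I) (F G : I -> fps R) K :
    (forall i, fps_eqmod K (F i) (G i)) ->
  fps_eqmod K (\prod_(i <- r) F i) (\prod_(i <- r) G i).
Proof.
move=> FG; elim: r => [|i r IHr]; first by rewrite !big_nil.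
by rewrite !big_cons; apply: fps_eqmodM.
Qed.

Lemma fps_eqmodV K f g : f \is a GRing.unit -> g \is a GRing.unit ->
  fps_eqmod K f g -> fps_eqmod K f^-1 g^-1.
Proof.
move=> Uf Ug fg; have : fps_eqmod K (f^-1 * g^-1 * g) (f^-1 * g^-1 * f).
  by apply: fps_eqmodM => // i /fg ->.
by rewrite divrK // mulrAC mulVr // mul1r.
Qed.

Lemma fps_coefqnM m f i : (fps_q ^+ m * f) i = if (m <= i)%N then f (i - m)%N else 0.
Proof.
rewrite fps_coefM; case: leqP => [le_mi|lt_im]; last first.
  rewrite big1 // => -[j /= lt_ji] _.
  by rewrite fps_coefqn ltn_eqF ?mul0r // (leq_ltn_trans _ lt_im) // -ltnS.
rewrite (bigD1 (Ordinal (le_mi : (m < i.+1)%N))) //= fps_coefqn eqxx mul1r.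
by rewrite big1 ?addr0 // => j ne_jm; rewrite fps_coefqn [_ == m]negbTE ?mul0r.
Qed.

Lemma fps_eqmodMqn K m f g :
  fps_eqmod K f g -> fps_eqmod (m + K) (fps_q ^+ m * f) (fps_q ^+ m * g).
Proof.
by move=> fg i lt_i; rewrite !fps_coefqnM; case: leqP => // le_mi; apply: fg; lia.
Qed.

Lemma fps_one_sub_qn_unit k : (0 < k)%N -> 1 - fps_q ^+ k \is a @GRing.unit (fps R).
Proof. by move=> k_gt0; rewrite fps_unitE fps_coefB fps_coefqn ltn_eqF ?subr0 ?unitr1. Qed.

Lemma fps_one_sub_q_unit : 1 - fps_q \is a @GRing.unit (fps R).
Proof. exact: (@fps_one_sub_qn_unit 1). Qed.

(* f(q) |-> f(q^(d+1)) *)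
Definition fps_dilate d f : fps R :=
  Fps (fun i => if (d.+1 %| i)%N then f (i %/ d.+1)%N else 0).

Definition fps_section d f : fps R := Fps (fun i => f (d.+1 * i)%N).

(** Extracting the exponents divisible by d + 1 is linear over the series in q^(d+1). *)
Lemma coef_dilateM d f g n : (fps_dilate d f * g) (d.+1 * n)%N = (f * fps_section d g) n.
Proof.
rewrite !fps_coefM.
transitivity (\sum_(i < (d.+1 * n).+1 | (d.+1 %| i)%N)
  f (i %/ d.+1)%N * g (d.+1 * n - i)%N).
  by rewrite [RHS]big_mkcond; apply: eq_bigr => i _ /=; case: ifP; rewrite ?mul0r.
rewrite (@sum_dvd_ordS _ (fun i => f (i %/ d.+1)%N * g (d.+1 * n - i)%N)) //.
by apply: eq_bigr => i _ /=; rewrite mulKn // mulnBr.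
Qed.

Fact fps_dilate_is_zmod_morphism d : zmod_morphism (fps_dilate d).
Proof.
by move=> f g; apply/fpsP => i /=; case: ifP => // _; rewrite subr0.
Qed.

Fact fps_dilate_is_monoid_morphism d : monoid_morphism (fps_dilate d).
Proof.
split=> [|f g]; apply/fpsP => i /=.
  case: dvdnP => [[k ->]|ndv]; first by rewrite mulnK // muln_eq0 orbF.
  by case: eqP => // i0; case: ndv; exists 0%N.
case: dvdnP => [[k ->]|ndv]; last first.
  rewrite big1 // => -[j /= lt_ji] _; case: dvdnP => [[u ju]|]; last by rewrite mul0r.
  case: dvdnP => [[v jv]|]; last by rewrite mulr0.
  by case: ndv; exists (u + v)%N; rewrite mulnDl -ju -jv subnKC // -ltnS.
rewrite mulnC mulKn //.
transitivity ((fps_dilate d f * fps_dilate d g) (d.+1 * k)%N); last by [].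
rewrite coef_dilateM; congr ((_ * _ : fps R) k).
by apply/fpsP => j /=; rewrite dvdn_mulr // mulKn.
Qed.

HB.instance Definition _ d :=
  GRing.isZmodMorphism.Build (fps R) (fps R) (fps_dilate d) (fps_dilate_is_zmod_morphism d).
HB.instance Definition _ d :=
  GRing.isMonoidMorphism.Build (fps R) (fps R) (fps_dilate d) (fps_dilate_is_monoid_morphism d).

Lemma fps_dilate_q d : fps_dilate d fps_q = fps_q ^+ d.+1.
Proof.
apply/fpsP => i; rewrite fps_coefqn /=; case: dvdnP => [[k ->]|ndv].
  by rewrite mulnK // -{2}[d.+1]mul1n eqn_mul2r.
by case: eqP => // E; case: ndv; exists 1%N; rewrite mul1n.
Qed.

Lemma fps_eqmod_dilate d K f g :
  fps_eqmod K f g -> fps_eqmod (d.+1 * K) (fps_dilate d f) (fps_dilate d g).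
Proof.
by move=> fg i lt_i /=; case: ifP => // _; apply: fg; rewrite ltn_divLR // mulnC.
Qed.

Lemma fps_coef_qM f i : (fps_q * f) i = if i is j.+1 then f j else 0.
Proof. by rewrite -[fps_q]expr1 fps_coefqnM; case: i => //= i; rewrite subSS subn0. Qed.

Lemma fps_geomE : (1 - fps_q)^-1 = Fps (fun=> 1) :> fps R.
Proof.
have U := fps_one_sub_q_unit.
apply: (mulrI U); rewrite divrr //; apply/fpsP => i.
by rewrite mulrBl mul1r fps_coefB fps_coef_qM; case: i => [|i] /=; rewrite ?subr0 ?subrr.
Qed.

Lemma fps_lambert1E : fps_q / (1 - fps_q) ^+ 2 = Fps (fun i => i%:R) :> fps R.
Proof.
have U := fps_one_sub_q_unit.
apply: (mulrI U); rewrite expr2 invrM // mulrCA mulVKr // fps_geomE.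
apply/fpsP => i; rewrite fps_coef_qM mulrBl mul1r fps_coefB fps_coef_qM.
by case: i => [|i] /=; rewrite ?subr0 // -addn1 natrD addrAC subrr add0r.
Qed.

Lemma fps_geom_dilate d : (1 - fps_q ^+ d.+1)^-1 = fps_dilate d (Fps (fun=> 1)) :> fps R.
Proof.
by rewrite -fps_geomE rmorphV ?fps_one_sub_q_unit // rmorphB rmorph1 /= fps_dilate_q.
Qed.

Lemma fps_lambert_dilate d :
  fps_q ^+ d.+1 / (1 - fps_q ^+ d.+1) ^+ 2 = fps_dilate d (Fps (fun i => i%:R)) :> fps R.
Proof.
rewrite -fps_lambert1E rmorphM rmorphV ?unitrX ?fps_one_sub_q_unit //.
by rewrite rmorphXn rmorphB rmorph1 /= fps_dilate_q.
Qed.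

(** The coefficient is the codivisor i / t, so summing over t produces sigma(i). *)
Lemma fps_lambert_coef t i : (0 < t)%N ->
  (fps_q ^+ t / (1 - fps_q ^+ t) ^+ 2 : fps R) i =
  if (t %| i)%N then (i %/ t)%:R else 0.
Proof. by case: t => // t _; rewrite fps_lambert_dilate. Qed.

End FpsCongruence.

(** * The generating function of spt as a sum of products over part sizes *)

Lemma fps_coefMn (R : comUnitRingType) (f : fps R) m i : (f *+ m) i = f i *+ m.
Proof. by elim: m => [|m IHm]; rewrite ?mulr0n // !mulrS fps_coefD IHm. Qed.

(* Weighting by the multiplicity of s and forbidding the parts below s, the
   number of appearances of s as a smallest part becomes a product over parts. *)
Definition spt_weight n (s i : 'I_n) k : nat :=
  if (i < s)%N then (k == 0)%N : nat else if i == s then k else 1%N.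

Lemma prod_spt_weight n (l : {ffun 'I_n -> 'I_n.+1}) s :
  (\prod_i spt_weight s i (l i) = if is_smallest_part l s then l s : nat else 0)%N.
Proof.
rewrite /is_smallest_part (bigD1 s) //= /spt_weight ltnn eqxx.
case: forallP => [min_s|not_min]; last first.
  rewrite andbF; have [i] : exists i : 'I_n, ~~ ((i < s)%N ==> (l i == 0 :> nat)).
    by apply/existsP; rewrite -negb_forall; apply/forallP.
  rewrite negb_imply => /andP[lt_is /negbTE li].
  rewrite (bigD1 i) /=; last by rewrite -val_eqE /= ltn_eqF.
  by rewrite lt_is li mul0n muln0.
rewrite andbT big1 ?muln1; first by case: (nat_of_ord (l s)).
by move=> i /negbTE ->; case: ifP => // lt_is; have := min_s i; rewrite lt_is /= => ->.
Qed.

(** Expanding the product chooses a multiplicity k for each part i + 1, hence gives one monomial per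
    function l, with exponent the sum of its parts. *)
Lemma spt_coef n :
  (spt n)%:Z = (\sum_(s < n) \prod_(i < n)
     \sum_(k < n.+1) (fps_q ^+ (i.+1 * k) *+ spt_weight s i k) : fps int) n.
Proof.
rewrite fps_coef_sum /spt.
under eq_bigr => l _ do rewrite big_mkcond.
rewrite exchange_big /= -[LHS]natz natr_sum; apply: eq_bigr => s _.
rewrite bigA_distr_bigA fps_coef_sum /= natr_sum big_mkcond; apply: eq_bigr => l _.
rewrite prodrMn -prod_spt_weight prodrXr fps_coefMn fps_coefqn /is_partition eq_sym.
by case: eqP => _; rewrite ?mul0rn.
Qed.

(** The full factor is the dilation by i + 1 of the series of weights; bounding multiplicities by n
    only loses exponents at least (i+1)(n+1) > n. *)
Lemma spt_factor_eqmod n (s i : 'I_n) :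
  fps_eqmod n.+1 (\sum_(k < n.+1) (fps_q ^+ (i.+1 * k) *+ spt_weight s i k) : fps int)
    (if (i < s)%N then 1
     else if i == s then fps_q ^+ i.+1 / (1 - fps_q ^+ i.+1) ^+ 2
     else (1 - fps_q ^+ i.+1)^-1).
Proof.
pose W : fps int := Fps (fun k => (spt_weight s i k)%:R).
have E1 : fps_eqmod n.+1 (\sum_(k < n.+1) (fps_q ^+ k *+ spt_weight s i k)) W.
  move=> j lt_jn; rewrite fps_coef_sum (bigD1 (Ordinal lt_jn)) //= big1 ?addr0.
    by rewrite fps_coefMn fps_coefqn eqxx.
  by move=> k /negbTE ne_kj; rewrite fps_coefMn fps_coefqn eq_sym [_ == _]ne_kj mul0rn.
have -> : (if (i < s)%N then 1
     else if i == s then fps_q ^+ i.+1 / (1 - fps_q ^+ i.+1) ^+ 2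
     else (1 - fps_q ^+ i.+1)^-1) = fps_dilate i W.
  rewrite /W /spt_weight fps_lambert_dilate fps_geom_dilate.
  case: ifP => _; last by case: ifP.
  by rewrite -[LHS](rmorph1 (fps_dilate i)); congr fps_dilate; apply/fpsP.
have -> : \sum_(k < n.+1) (fps_q ^+ (i.+1 * k) *+ spt_weight s i k) =
    fps_dilate i (\sum_(k < n.+1) (fps_q ^+ k *+ spt_weight s i k)) :> fps int.
  rewrite rmorph_sum; apply: eq_bigr => k _.
  by rewrite rmorphMn rmorphXn /= fps_dilate_q exprM.
by apply: fps_eqmodW (fps_eqmod_dilate E1); rewrite leq_pmull.
Qed.

(** * Both generating functions as truncated Bailey sums *)

Local Notation fps_lambert t := (fps_q ^+ t / (1 - fps_q ^+ t) ^+ 2 : fps int).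
Local Notation fps_P := (qfact (fps_q : fps int)).

Lemma qfact_add (R : pzRingType) (q : R) m k :
  qfact q (m + k) = qfact q m * \prod_(i < k) (1 - q ^+ (m + i).+1).
Proof. by rewrite /qfact big_split_ord. Qed.

Lemma rmorph_qfact (R S : pzRingType) (f : {rmorphism R -> S}) q n :
  f (qfact q n) = qfact (f q) n.
Proof.
by rewrite rmorph_prod; apply: eq_bigr => i _; rewrite rmorphB rmorph1 rmorphXn.
Qed.

Lemma rmorph_pent_alpha (R S : pzRingType) (f : {rmorphism R -> S}) q r :
  f (pent_alpha q r) = pent_alpha (f q) r.
Proof.
rewrite /pent_alpha; case: eqP => _; first exact: rmorph1.
by rewrite !rmorphM rmorphD rmorph1 !rmorphXn rmorphN1.
Qed.

Lemma fps_qU k : (0 < k)%N -> 1 - fps_q ^+ k \is a @GRing.unit (fps int).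
Proof. exact: fps_one_sub_qn_unit. Qed.

Lemma fps_P_unit n : fps_P n \is a GRing.unit.
Proof. exact: (qfact_unit fps_qU). Qed.

Lemma fps_qfact_eqmod K m : (K <= m)%N -> fps_eqmod K.+1 (fps_P m) (fps_P K).
Proof.
move=> le_Km; rewrite -(subnKC le_Km) qfact_add -[X in fps_eqmod _ _ X]mulr1.
apply: fps_eqmodM => //.
rewrite -[X in fps_eqmod _ _ X](@big1_eq _ _ *%R _ (index_enum 'I_(m - K)) xpredT).
apply: fps_eqmod_prod => i j lt_j.
by rewrite fps_coefB fps_coefqn ltn_eqF ?subr0 // (leq_trans lt_j) // ltnS leq_addr.
Qed.

(** The weight (q)_N^2 / ((q)_(N-r) (q)_(N+r)) is shown to be 1 only modulo q^(N-r+1); the factor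
    q^r of the Lambert term restores the missing r degrees. *)
Lemma bailey_weight_eqmod N r : (0 < r <= N)%N ->
  fps_eqmod N.+1 (fps_lambert r * fps_P N ^+ 2 * bailey_term fps_q N r) (fps_lambert r).
Proof.
move=> /andP[r_gt0 le_rN]; have -> : (N.+1 = r + (N - r).+1)%N by rewrite addnS subnKC.
have U := fps_P_unit (N - r).
have W : fps_eqmod (N - r).+1 (fps_P N ^+ 2 * bailey_term fps_q N r) 1.
  have -> : 1 = fps_P (N - r) ^+ 2 * ((fps_P (N - r))^-1 * (fps_P (N - r))^-1).
    by rewrite mulrA expr2 mulrK ?divrr.
  rewrite /bailey_term /inv_qfact_sub le_rN; apply: fps_eqmodM.
    by rewrite !expr2; apply: fps_eqmodM; apply: fps_qfact_eqmod; rewrite leq_subr.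
  apply: fps_eqmodM => //; apply: fps_eqmodV; rewrite ?fps_P_unit //.
  by apply: fps_qfact_eqmod; lia.
rewrite -[_ * _ * bailey_term _ _ _]mulrA -[_ / _ * (_ * _)]mulrA; apply: fps_eqmodMqn.
by rewrite -[X in fps_eqmod _ _ X]mulr1; apply: fps_eqmodM.
Qed.

(* The term r = 0 of the last sum vanishes, since 0^-1 = 0. *)
Lemma fps_bailey_sum (a b : nat -> fps int) N :
    (forall n, (0 < n)%N -> b n = \sum_(r < n.+1) a r * bailey_term fps_q n r) ->
    a 0%N = 1 ->
  fps_eqmod N.+1 (\sum_(1 <= n < N.+1) fps_P n.-1 ^+ 2 * fps_q ^+ n * b n)
    (\sum_(1 <= n < N.+1) fps_lambert n + \sum_(r < N.+1) a r * fps_lambert r).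
Proof.
move=> bE a0; rewrite (bailey_sum fps_qU N bE) a0 mul1r; apply: fps_eqmodD => //.
rewrite big_ord_recl subrr expr0n invr0 !mulr0 add0r big_add1 big_mkord /=.
apply: fps_eqmod_sum => i _; apply: fps_eqmodM => //.
by apply: bailey_weight_eqmod; rewrite /= ltn_ord.
Qed.

(** The index s stands for the part s + 1. Factoring out 1 / (q)_n leaves the Bailey summand for
    b_(s+1) = 1 / (q)_(s+1). *)
Lemma prod_spt_factor n (s : 'I_n) :
  \prod_(i < n) (if (i < s)%N then 1 else if i == s then fps_lambert i.+1
     else (1 - fps_q ^+ i.+1)^-1) =
  (fps_P n)^-1 * (fps_P s ^+ 2 * fps_q ^+ s.+1 * (fps_P s.+1)^-1).
Proof.
apply: (mulrI (fps_P_unit n)); rewrite mulVKr ?fps_P_unit // {1}/qfact -big_split /=.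
transitivity (\prod_(i < n) ((if i == s then fps_lambert s.+1 else 1) *
                             (if (i < s.+1)%N then 1 - fps_q ^+ i.+1 else 1))).
  apply: eq_bigr => i _; rewrite ltnS; case: (ltngtP i s) => [lt_is|lt_si|/val_inj ->].
  - by rewrite mulr1 ifN ?mul1r // -val_eqE /= ltn_eqF.
  - by rewrite ifN -?val_eqE /= ?gtn_eqF // divrr ?fps_qU // mulr1.
  by rewrite eqxx mulrC.
rewrite big_split /= -!big_mkcond big_pred1_eq.
rewrite -(big_ord_widen n (fun i => 1 - fps_q ^+ i.+1)) //.
rewrite -/(fps_P s.+1) qfactS.
have U := fps_P_unit s; have U1 := @fps_qU s.+1 isT.
have E := divrr U; have E1 := divrr U1.
rewrite (invrM U U1) -exprVn; move: (_ ^-1) ((fps_P s)^-1) E1 E => u v E1 E.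
transitivity (fps_q ^+ s.+1 * u * fps_P s * ((1 - fps_q ^+ s.+1) * u)); first by ring.
by rewrite E1 -[in LHS]E; ring.
Qed.

Lemma spt_bailey n :
  (spt n)%:Z = ((fps_P n)^-1 *
    (\sum_(1 <= t < n.+1) fps_lambert t +
     \sum_(r < n.+1) pent_alpha fps_q r * fps_lambert r)) n.
Proof.
rewrite spt_coef.
have E : fps_eqmod n.+1
    (\sum_(s < n) \prod_(i < n)
       \sum_(k < n.+1) (fps_q ^+ (i.+1 * k) *+ spt_weight s i k) : fps int)
    (\sum_(s < n) (fps_P n)^-1 * (fps_P s ^+ 2 * fps_q ^+ s.+1 * (fps_P s.+1)^-1)).
  apply: fps_eqmod_sum => s _; rewrite -prod_spt_factor.
  by apply: fps_eqmod_prod => i; apply: spt_factor_eqmod.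
rewrite E // -big_distrr.
apply: (@fps_eqmodM _ n.+1 _ _ _ _ _ _ n (ltnSn n)) => //.
have -> : \sum_(s < n) (fps_P s ^+ 2 * fps_q ^+ s.+1 / fps_P s.+1) =
    \sum_(1 <= s < n.+1) (fps_P s.-1 ^+ 2 * fps_q ^+ s / fps_P s).
  by rewrite big_add1 big_mkord.
by apply: fps_bailey_sum => // m _; apply: (pent_bailey fps_qU).
Qed.

(** The factors (q)_(t-1) and (q^3; q^3)_(t-1) complete (q^t; q)_t and (q^(3t); q^3)_oo to products
    starting at q and q^3. The latter may then be cut to n factors, independently of t. *)
Lemma spt23_term_eqmod n t : (0 < t)%N ->
  fps_eqmod (3 * n).+1 (spt23_term t)
    (fps_dilate 2 (fps_P n)^-1 *
     (fps_P t.-1 ^+ 2 * fps_q ^+ t *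
      (qfact (fps_q ^+ 3) t.-1 / fps_P (t.*2.-1) / fps_P t))).
Proof.
case: t => // t _; rewrite /spt23_term /=; set N := (3 * n).+1.
have dilateP m : fps_dilate 2 (fps_P m) = qfact (fps_q ^+ 3) m.
  by rewrite rmorph_qfact /= fps_dilate_q.
pose X := qpoch (fps_q ^+ (3 * t.+1)) (fps_q ^+ 3) N : fps int.
pose Y := qpoch (fps_q ^+ t.+1) fps_q t.+1 : fps int.
have EX : qfact (fps_q ^+ 3) (t + N) = qfact (fps_q ^+ 3) t * X.
  rewrite qfact_add; congr (_ * _); apply: eq_bigr => i _.
  by rewrite -addSn exprD !exprM.
have EY : fps_P (t.+1.*2.-1) = fps_P t * Y.
  rewrite -addnn addSn qfact_add; congr (_ * _); apply: eq_bigr => i _.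
  by rewrite -addSn exprD.
have U3 m : qfact (fps_q ^+ 3) m \is a @GRing.unit (fps int).
  by rewrite -dilateP rmorph_unit ?fps_P_unit.
have UX : X \is a GRing.unit by have := U3 (t + N)%N; rewrite EX unitrM => /andP[].
have UY : Y \is a GRing.unit.
  by have := fps_P_unit (t.+1.*2.-1); rewrite EY unitrM => /andP[].
have Ut := @fps_qU t.+1 isT; have UP := fps_P_unit t.
have E : ((1 - fps_q ^+ t.+1) * Y * X)^-1 =
    (qfact (fps_q ^+ 3) (t + N))^-1 *
    (fps_P t ^+ 2 * (qfact (fps_q ^+ 3) t / fps_P (t.+1.*2.-1) / fps_P t.+1)).
  have UYt : (1 - fps_q ^+ t.+1) * Y \is a GRing.unit by rewrite unitrM Ut UY.
  rewrite EX EY qfactS (invrM UYt UX) (invrM Ut UY) (invrM (U3 t) UX) (invrM UP UY).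
  rewrite (invrM UP Ut); have EP := divrr UP; have E3 := divrr (U3 t).
  move: (fps_P t) (fps_P t)^-1 EP => p p' EP.
  move: (qfact _ t) (qfact _ t)^-1 E3 => r r' E3.
  move: (1 - _)^-1 Y^-1 X^-1 => u y x.
  transitivity (x * (y * u) * (p * p') ^+ 2 * (r * r')); last by ring.
  by rewrite EP E3 expr1n !mulr1.
(* Modulo q^N, N factors of the infinite product suffice, so it is replaced by X. *)
apply: (@fps_eqmod_trans _ _ _ (fps_q ^+ t.+1 / ((1 - fps_q ^+ t.+1) * Y * X))).
  apply: fps_eqmodM => //; apply: fps_eqmodV.
  - exact: spt23_denom_unit.
  - by rewrite !unitrM Ut UY.
  apply: fps_eqmodM => // i lt_i; rewrite -(@qpoch_infE _ _ _ _ N) //.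
  by rewrite fps_coefqn.
rewrite E mulrCA [fps_P t ^+ 2 * _ * _]mulrAC [fps_q ^+ _ * _]mulrC; apply: fps_eqmodM => //.
rewrite -dilateP -rmorphV ?fps_P_unit //.
(* Dilation triples precision: agreement modulo q^(n+1) becomes agreement modulo q^(3n+3), more than
   the 3n + 1 required. *)
apply: (@fps_eqmodW _ (3 * n.+1)); first by rewrite /N; lia.
apply: fps_eqmod_dilate; apply: fps_eqmodV; rewrite ?fps_P_unit //.
by apply: fps_qfact_eqmod; rewrite /N; lia.
Qed.

Lemma spt23_bailey n :
  spt23 (3 * n)%N = ((fps_P n)^-1 *
    (fps_section 2 (\sum_(1 <= t < (3 * n).+1) fps_lambert t) +
     \sum_(r < n.+1) pent_alpha fps_q r * fps_lambert r)) n.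
Proof.
rewrite /spt23 -(@fps_sum1E _ _ spt23_term_order (3 * n).+1) //.
set N := (3 * n)%N; set a := cubic_alpha (fps_q : fps int).
pose A := \sum_(1 <= t < N.+1) fps_lambert t.
pose B := \sum_(r < n.+1) pent_alpha fps_q r * fps_lambert r.
have EB : \sum_(r < N.+1) a r * fps_lambert r = fps_dilate 2 B.
  transitivity (\sum_(r < N.+1 | (3 %| r)%N) a r * fps_lambert r).
    rewrite [RHS]big_mkcond; apply: eq_bigr => r _.
    by rewrite /a /cubic_alpha; case: ifP; rewrite ?mul0r.
  rewrite (@sum_dvd_ordS _ (fun r => a r * fps_lambert r)) // rmorph_sum.
  apply: eq_bigr => -[[|r] /= _] _.
    (* At r = 0 both Lambert terms are 0, since 0^-1 = 0. *)
    by rewrite subrr expr0n invr0 !mulr0 rmorph0.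
  rewrite /a cubic_alphaM rmorphM rmorph_pent_alpha rmorphM rmorphV ?unitrX ?fps_qU //.
  by rewrite !rmorphXn rmorphB rmorph1 rmorphXn /= fps_dilate_q -exprM.
transitivity ((fps_dilate 2 (fps_P n)^-1 * (A + fps_dilate 2 B)) N).
  rewrite -EB; apply: (@fps_eqmod_trans _ N.+1 _ (fps_dilate 2 (fps_P n)^-1 *
    \sum_(1 <= t < N.+1) fps_P t.-1 ^+ 2 * fps_q ^+ t *
      (qfact (fps_q ^+ 3) t.-1 / fps_P (t.*2.-1) / fps_P t))) (ltnSn N).
    rewrite big_distrr; apply: fps_eqmod_sum => t.
    by rewrite mem_index_iota => /andP[t_gt0 _]; apply: spt23_term_eqmod.
  apply: fps_eqmodM => //; apply: fps_bailey_sum => // m m_gt0.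
  exact: (cubic_bailey fps_qU).
rewrite coef_dilateM; congr ((_ * _ : fps int) n).
by apply/fpsP => i /=; rewrite dvdn_mulr // mulKn.
Qed.

(** For j > 0 this is sigma(3j) = sigma(j) modulo 3: a divisor 3t of 3j has codivisor j / t, so the
    divisors of 3j that are multiples of 3 contribute exactly sigma(j). *)
Lemma lambert_section_mod3 n j : (j <= n)%N ->
  (3 %| fps_section 2 (\sum_(1 <= t < (3 * n).+1) fps_lambert t) j -
        (\sum_(1 <= t < n.+1) fps_lambert t) j)%Z.
Proof.
move=> le_jn; rewrite /= !fps_coef_sum.
pose F t : int := if (t %| 3 * j)%N then (3 * j %/ t)%:R else 0.
have F0 : F 0%N = 0.
  by rewrite /F dvd0n; case: ifP => //; rewrite divn0.
have -> : \sum_(1 <= t < (3 * n).+1) (fps_lambert t) (3 * j)%N = \sum_(t < (3 * n).+1) F t.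
  rewrite big_ord_recl F0 add0r big_add1 big_mkord.
  by apply: eq_bigr => t _; rewrite fps_lambert_coef.
have -> : \sum_(1 <= t < n.+1) (fps_lambert t) j = \sum_(t < n.+1) F (3 * t)%N.
  rewrite big_ord_recl muln0 F0 add0r big_add1 big_mkord.
  by apply: eq_bigr => t _; rewrite fps_lambert_coef // /F dvdn_pmul2l // divnMl.
rewrite -sum_dvd_ordS // (bigID (fun t : 'I_ _ => (3 %| t)%N)) /= addrAC subrr add0r.
(* A divisor t of 3j prime to 3 divides j, so 3j / t is a multiple of 3. *)
apply: rpred_sum => t ndv3t.
rewrite /F; case: ifP => [dv_t|]; last by rewrite dvdz0.
have dv_tj : (t %| j)%N by rewrite -(@Gauss_dvdr t 3) // coprime_sym prime_coprime.
by rewrite -muln_divA // natz; apply/dvdn_mulr.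
Qed.

Theorem theorem4 (n : nat) (n_ge1 : (1 <= n)%N) :
  (spt23 (3 * n)%N = (spt n)%:Z %[mod 3])%Z.
Proof.
apply/eqP; rewrite eqz_mod_dvd spt_bailey spt23_bailey -fps_coefB -mulrBr.
(* The pentagonal sums cancel, leaving 1 / (q)_n times a series whose coefficients up to degree n
   are divisible by 3. *)
rewrite opprD addrACA subrr addr0 fps_coefM.
apply: rpred_sum => -[i /= _] _; apply: dvdz_mull.
by apply: lambert_section_mod3; apply: leq_subr.
Qed.
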